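(* Let $(X,d)$ be a complete metric space, let $k\in\mathbb{N}$, and let $T:\prod_{l=1}^{k}X\to X$ be a Kannan-Geraghty $H_k$ contraction. Then $T$ has a fixed point $u$, i.e. there is $u\in X$ with $T(u,\ldots,u)=u$, and every $k$-Picard sequence with respect to $T$ converges to $u$.
   Context: $\mathbb{N}$ denotes the set of positive integers; metric spaces are nonempty. $\prod_{l=1}^{k}X=X^k$. $\mathbb{G}$ denotes the set of all functions $\beta:[0,\infty)\to[0,1)$ such that, for every sequence $(t_n)$ in $[0,\infty)$, $\lim_{n\to\infty}\beta(t_n)=1$ implies $\lim_{n\to\infty}t_n=0$. Kannan-Geraghty $H_k$ contraction (of dimension $k$): $T:\prod_{l=1}^{k}X\to X$ is so called if there is $\beta\in\mathbb{G}$ such that for all $u_1,\ldots,u_k,v_1,\ldots,v_k\in X$, $$d\big(T(u_1,\ldots,u_k),T(v_1,\ldots,v_k)\big)\le\frac{\beta(d(u_k,v_k))}{2}\Big(d\big(T(u_1,\ldots,u_k),u_k\big)+d\big(T(v_1,\ldots,v_k),v_k\big)\Big).$$ $k$-Picard sequence with respect to $T$: for base points $x_1,\ldots,x_k\in X$, the sequence defined recursively by $x_{n+k}:=T(x_n,x_{n+1},\ldots,x_{n+k-1})$ for all $n\ge1$. *)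

(* Defs.v *)
From HB Require Import structures.
From mathcomp Require Import all_boot all_order all_algebra.
From mathcomp Require Import all_classical all_reals all_analysis.

Set Implicit Arguments.
Unset Strict Implicit.
Unset Printing Implicit Defensive.

Import Order.TTheory GRing.Theory Num.Theory.
Import numFieldNormedType.Exports.

Local Open Scope classical_set_scope.
Local Open Scope ring_scope.

(* [Complete] includes a point, so these spaces are nonempty. *)
#[short(type="completeMetricType")]
HB.structure Definition CompleteMetric (R : numDomainType) :=
  {X of Complete X & Metric R X}.

(* Functions [0, +oo[ -> [0, 1[ are represented by total functions R -> R
   whose values at negative arguments are irrelevant. *)
Definition geraghty (R : realType) (beta : R -> R) : Prop :=
  (forall t, 0 <= t -> 0 <= beta t < 1) /\
  (forall t : nat -> R, (forall n, 0 <= t n) ->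
     beta (t n) @[n --> \oo] --> (1 : R) -> t n @[n --> \oo] --> (0 : R)).

(* The product of m copies of X is 'I_m -> X. Dimensions are positive, hence
   written k.+1; the last coordinate of u is then u ord_max. *)
Definition kannan_geraghty (R : realType) (X : metricType R) (k : nat)
    (T : ('I_k.+1 -> X) -> X) : Prop :=
  exists2 beta : R -> R, geraghty beta &
  forall u v : 'I_k.+1 -> X,
    mdist (T u) (T v) <=
      beta (mdist (u ord_max) (v ord_max)) / 2 *
      (mdist (T u) (u ord_max) + mdist (T v) (v ord_max)).

(* Sequences are indexed from 0, so the base points x 0, ..., x k are the
   unconstrained terms. *)
Definition picard_sequence (X : Type) (k : nat) (T : ('I_k.+1 -> X) -> X)
    (x : nat -> X) : Prop :=
  forall n, x (n + k.+1)%N = T (fun i => x (n + i)%N).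

(* Main.v *)
Require Import Defs.
From mathcomp Require Import all_boot all_order all_algebra.
From mathcomp Require Import all_classical all_reals all_analysis.
From mathcomp Require Import lra.
Import Order.TTheory GRing.Theory Num.Theory.
Import numFieldNormedType.Exports.
Local Open Scope classical_set_scope.
Local Open Scope ring_scope.

(** A Picard sequence moves a window of length k+1 along itself, and the
    contraction inequality sees a window only through its last entry and its
    value under T.  So only sequences of windows w are considered, such that
    the last entry of w (n+1) is T (w n).  Put d n = mdist (T (w n)) (last
    entry of w n).  Applied to w (n+1) and w n, the contraction becomes the
    scalar inequality d (n+1) <= beta (d n) / 2 * (d (n+1) + d n).

    - As beta < 1, d is nonincreasing, hence converges to some r >= 0.  If
      r > 0, the inequality squeezes beta (d n) between r / d n and 1, so the
      Geraghty property gives d n --> 0; thus r = 0 in every case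
      ([geraghty_recurrence_cvg0]).
    - Bounding beta by 1 leaves the Kannan inequality
      mdist (T u) (T v) <= (displacement of u + displacement of v) / 2
      ([kannan_geraghty_kannan]).  Together with d n --> 0 it makes the values
      T (w n) a Cauchy sequence and shows that their limit is a fixed point
      ([window_orbit_cvg_fixed]).  On its own it forbids two fixed points
      ([kannan_geraghty_fixed_unique]), as these have displacement 0.

    The constant windows at the iterates of u |-> T (u, ..., u) give one such
    sequence, hence a fixed point; the windows of any Picard sequence give
    another, and its limit is the same point by uniqueness. *)

(** The squeeze uses r <= d (n+1) and, d being nonincreasing,
    d n + d (n+1) <= 2 d n; this turns the recurrence into
    r / d n <= beta (d n). *)
Lemma geraghty_recurrence_cvg0 (R : realType) (beta : R -> R) (d : nat -> R) :
    geraghty beta -> (forall n, 0 <= d n) ->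
    (forall n, d n.+1 <= beta (d n) / 2 * (d n.+1 + d n)) ->
  d n @[n --> \oo] --> (0 : R).
Proof.
move=> [beta01 betaG] d0 drec.
have dS n : d n.+1 <= d n.
  have /andP[b0 b1] := beta01 _ (d0 n).
  have := drec n; have := d0 n; have := d0 n.+1; nra.
have dd : nonincreasing_seq d by apply/nonincreasing_seqP.
have dcv : cvgn d.
  by apply: nonincreasing_is_cvgn => //; exists 0 => _ [n _ <-].
have dr := nonincreasing_cvgn_ge dd dcv.
move: dcv dr; set r := limn d => dcv dr.
have r0 : 0 <= r by apply: limr_ge => //; apply: nearW.
have [r_gt0|r_le0] := ltP 0 r; last first.
  have -> : 0 = r :> R by apply/eqP; rewrite eq_le r0 r_le0.
  exact: dcv.
apply: betaG => //.
apply: (@squeeze_cvgr _ _ _ _ (fun n => r * (d n)^-1) (fun=> 1)).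
- apply: nearW => n.
  have /andP[b0 b1] := beta01 _ (d0 n).
  have dn0 : 0 < d n by exact: lt_le_trans (dr n).
  rewrite (ltW b1) andbT ler_pdivrMr//.
  have := drec n; have := dr n.+1; have := dS n; nra.
- rewrite -(@divff _ r) ?gt_eqF//.
  by apply: cvgM; [exact: cvg_cst | apply: cvgV; rewrite ?gt_eqF].
- exact: cvg_cst.
Qed.

(** Nothing relates the other entries of successive windows, so that the
    sliding windows of a Picard sequence and the constant windows at iterates
    of the diagonal map are both instances. *)
Definition window_orbit {X : Type} {k : nat} (T : ('I_k.+1 -> X) -> X)
    (w : nat -> 'I_k.+1 -> X) : Prop :=
  forall n, w n.+1 ord_max = T (w n).

Section KannanGeraghty.
Context {R : realType} {X : metricType R} {k : nat}.
Context {T : ('I_k.+1 -> X) -> X}.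

Lemma kannan_geraghty_kannan (hT : kannan_geraghty T) (u v : 'I_k.+1 -> X) :
  mdist (T u) (T v) <=
    (mdist (T u) (u ord_max) + mdist (T v) (v ord_max)) / 2.
Proof.
have [beta [beta01 _] Tbeta] := hT.
have := beta01 _ (mdist_ge0 (u ord_max) (v ord_max)).
have := Tbeta u v.
have := mdist_ge0 (T u) (u ord_max); have := mdist_ge0 (T v) (v ord_max).
nra.
Qed.

Lemma kannan_geraghty_fixed_unique (hT : kannan_geraghty T) {u v : X} :
  T (fun=> u) = u -> T (fun=> v) = v -> u = v.
Proof.
move=> Tu Tv; apply: mdist_positivity; apply/eqP.
rewrite eq_le mdist_ge0 andbT.
have := kannan_geraghty_kannan hT (fun=> u) (fun=> v).
by rewrite Tu Tv !mdistxx addr0 mul0r.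
Qed.

Lemma window_orbit_displacement_cvg0 (hT : kannan_geraghty T)
    {w : nat -> 'I_k.+1 -> X} : window_orbit T w ->
  mdist (T (w n)) (w n ord_max) @[n --> \oo] --> (0 : R).
Proof.
have [beta betaG Tbeta] := hT.
move=> wT; apply: (geraghty_recurrence_cvg0 _ _ _ betaG) => n.
  exact: mdist_ge0.
by have := Tbeta (w n.+1) (w n); rewrite wT.
Qed.

End KannanGeraghty.

Section Limit.
Context {R : realType} {X : completeMetricType R} {k : nat}.
Context {T : ('I_k.+1 -> X) -> X}.

(** The limit u is fixed because the Kannan inequality for the diagonal at u
    and w n bounds the displacement D of that diagonal by
    (D + d n) / 2 + mdist u (T (w n)); the coefficient 1/2 of D is absorbed
    and the rest tends to 0. *)
Lemma window_orbit_cvg_fixed (hT : kannan_geraghty T)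
    {w : nat -> 'I_k.+1 -> X} : window_orbit T w ->
  exists2 u : X, T (fun=> u) = u & w n ord_max @[n --> \oo] --> u.
Proof.
move=> wT; have d0 := window_orbit_displacement_cvg0 hT wT.
have dlt e : 0 < e -> \forall n \near \oo, mdist (T (w n)) (w n ord_max) < e.
  move=> e0; have /cvgr0Pnorm_lt/(_ e e0) := d0.
  by apply: filterS => n; rewrite ger0_norm ?mdist_ge0.
have /cauchy_cvgP Tw_cvg : cauchy (T (w n) @[n --> \oo]).
  apply/cauchy_exP => e e0; have [N _ dN] := dlt _ e0.
  exists (T (w N)); exists N => //= n Nn; rewrite ballEmdist /=.
  apply: le_lt_trans (kannan_geraghty_kannan hT _ _) _.
  have := dN N (leqnn N); have := dN n Nn; rewrite /=; lra.
pose u := lim (T (w n) @[n --> \oo]).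
have Tw_u : T (w n) @[n --> \oo] --> u by exact: Tw_cvg.
exists u; last first.
  rewrite -cvg_shiftS (_ : [sequence _]_n = T \o w)//.
  by apply/funext => n /=; rewrite wT.
apply: mdist_positivity; apply/eqP; rewrite eq_le mdist_ge0 andbT.
apply/ler_addgt0Pl => e e0; rewrite addr0.
have e3 : 0 < e / 3 by rewrite divr_gt0.
near \oo => n.
have dn : mdist (T (w n)) (w n ord_max) < e / 3 by near: n; exact: dlt.
have un : mdist u (T (w n)) < e / 3.
  by near: n; move/metricType_numDomainType.cvgrPdist_lt: Tw_u; exact.
have := kannan_geraghty_kannan hT (fun=> u) (w n).
have := metric_triangle (T (fun=> u)) (T (w n)) u.
rewrite (metric_sym (T (w n)) u) /=; lra.
Unshelve. all: by end_near. Qed.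

End Limit.

Theorem corollary2p1 (R : realType) (X : completeMetricType R) (k : nat)
    (T : ('I_k.+1 -> X) -> X) (hT : kannan_geraghty T) :
  exists u : X,
    T (fun=> u) = u /\
    forall x : nat -> X, picard_sequence T x -> x n @[n --> \oo] --> u.
Proof.
pose f (v : X) := T (fun=> v).
have [|u Tu _] := @window_orbit_cvg_fixed _ _ _ _ hT
  (fun n => fun=> iter n f point); first by [].
exists u; split=> // x xT.
have [n|v Tv xv] := @window_orbit_cvg_fixed _ _ _ _ hT
  (fun n i => x (n + i)%N).
  by rewrite -xT /= addSnnS.
rewrite (kannan_geraghty_fixed_unique hT Tu Tv).
by rewrite -(cvg_shiftn k).
Qed.
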